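(* Let $A$ be a finite set of prisoners with $|A|\ge2$, $K$ an infinite set of colors, $V$ a visibility graph on $A$, and $I$ an inning function on $A$ with $IN\ge2$. Suppose the hat game $\mathcal{G}=(A,K,V,I)$ satisfies (S3) for every $a\in A$, $V(a)\cap H(a)=\emptyset$. If $\mathcal{G}$ has a predictor under which, for every coloring, at most one prisoner guesses incorrectly, then $\mathcal{G}$ satisfies (S1) $|I_1|=1$, and (S4) every prisoner $a\in I_1$ satisfies $V(a)=A\setminus\{a\}$.
   Context: A hat game $(A,K,V,I)$ consists of: a set $A$ of prisoners and a set $K$ of colors (with $|A|,|K|\ge2$); a visibility graph $V\subseteq A^2$ with no loops, where $(a,b)\in V$ means $a$ sees $b$'s hat, and $V(a)=\{b:(a,b)\in V\}$; and an inning function $I$, a surjection from $A$ onto $\{\beta:1\le\beta\le\alpha\}$ for some nonzero ordinal $\alpha$. Write $IN=\max\operatorname{ran}(I)$, $I_\beta=\{a:I(a)=\beta\}$, and $H(a)=\{b:I(b)<I(a)\}$. A coloring is $f\in K^A$. Strategies: for each $a$, a function $S_a:K^{H(a)}\times K^{V(a)}\to K$; guesses are defined by recursion on $I(a)$ as $\sigma_a(f)=S_a(h_a^f,f\restriction V(a))$ with $h_a^f=(\sigma_b(f))_{b\in H(a)}$. A predictor is $P:K^A\to K^A$ with $P(f)(a)=\sigma_a(f)$ for some family of strategies. Prisoner $a$ guesses incorrectly under $f$ if $P(f)(a)\ne f(a)$. *)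

(* Defs.v *)
From mathcomp Require Import boolp classical_sets cardinality.
From mathcomp Require Import all_boot.

Set Implicit Arguments.
Unset Strict Implicit.
Unset Printing Implicit Defensive.

Section HatGame.
Variables (A : finType) (K : Type).

(* [V a b] means that [a] sees the hat of [b]. *)
Definition visibility_graph (V : rel A) : Prop := irreflexive V.

Definition seen (V : rel A) (a : A) : {set A} := [set b | V a b].

(* As [A] is finite, an ordinal alpha such that A maps onto
   {beta : 1 <= beta <= alpha} is finite; innings are therefore numbered by
   [nat], starting from 1. *)
Definition inning_function (I : A -> nat) : Prop :=
  exists2 alpha : nat, alpha != 0 &
    forall beta : nat, (exists a : A, I a = beta) <-> 1 <= beta <= alpha.

Definition last_inning (I : A -> nat) : nat := \max_(a : A) I a.

Definition inning (I : A -> nat) (beta : nat) : {set A} :=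
  [set a | I a == beta].

Definition heard (I : A -> nat) (a : A) : {set A} := [set b | I b < I a].

Definition strategy (V : rel A) (I : A -> nat) (a : A) : Type :=
  ({b : A | b \in heard I a} -> K) -> ({b : A | b \in seen V a} -> K) -> K.

Lemma heard_wf (I : A -> nat) : well_founded (fun b a => b \in heard I a).
Proof.
move=> a; have [n] := ubnP (I a); elim: n a => [a|n IHn a leIan].
  by rewrite ltn0.
constructor=> b; rewrite inE => ltIba; apply: IHn.
exact: leq_trans ltIba leIan.
Qed.

Definition guess (V : rel A) (I : A -> nat) (S : forall a, strategy V I a)
    (f : A -> K) : A -> K :=
  Fix (heard_wf I) (fun=> K) (fun a guess_before =>
    S a (fun b => guess_before (val b) (valP b)) (fun b => f (val b))).

Lemma guessE (V : rel A) (I : A -> nat) (S : forall a, strategy V I a)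
    (f : A -> K) (a : A) :
  guess S f a = S a (fun b => guess S f (val b)) (fun b => f (val b)).
Proof.
apply: (Fix_eq (heard_wf I) (fun=> K) _ _ a) => x g h gh.
by congr (S x _ _); apply: funext => b; apply: gh.
Qed.

Definition predictor (V : rel A) (I : A -> nat) (P : (A -> K) -> A -> K) : Prop :=
  exists S : forall a, strategy V I a, forall f a, P f a = guess S f a.

Definition guesses_incorrectly (P : (A -> K) -> A -> K) (f : A -> K) (a : A) :
  Prop := P f a <> f a.

End HatGame.

Arguments predictor {A K}.

(* Main.v *)
Require Import Defs.
From mathcomp Require Import boolp classical_sets cardinality.
From mathcomp Require Import all_boot.

(** Two prisoners [a != b] of the first inning can both be made wrong: the guess
    of [b] ignores the hat of [b], so one hat for [b] makes [b] wrong for two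
    different hats of [a]; the guess of [a] ignores the hat of [a], so it is wrong
    for one of these two.

    Now let [a] be the unique first guesser and suppose that [a] does not see
    [c].  When [a] is wrong, all others are right, so what [c] hears is the guess
    of [a] and true hats of prisoners other than [c].  None of this depends on
    the hat of [c], and neither does the wrongness of [a]; yet [c] has to be
    right for every hat of [c]. *)

Lemma infinite_avoid2 {K : Type} (hK : infinite_set [set: K]%classic) (x y : K) :
  exists z, z <> x /\ z <> y.
Proof.
apply: contrapT => noz; apply: hK.
apply: (@sub_finite_set _ _ [set x; y]%classic) => [z _ /=|].
  by apply: contrapT => /not_orP zxy; apply: noz; exists z.
by rewrite finite_setU; split; apply: finite_set1.
Qed.

Section Recolor.
Context {A : finType} {K : Type}.

Definition recolor (f : A -> K) (a : A) (x : K) : A -> K :=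
  fun b => if b == a then x else f b.

Lemma recolorE (f : A -> K) a x : recolor f a x a = x.
Proof. by rewrite /recolor eqxx. Qed.

Lemma recolor_neq (f : A -> K) a x b : b != a -> recolor f a x b = f b.
Proof. by rewrite /recolor => /negbTE->. Qed.

End Recolor.

Section Guess.
Context {A : finType} {K : Type} {V : rel A} {I : A -> nat}.
Variable S : forall a, @strategy A K V I a.

Lemma guess_local (f g : A -> K) a :
    (forall b, I b < I a -> guess S f b = guess S g b) ->
    (forall b, V a b -> f b = g b) ->
  guess S f a = guess S g a.
Proof.
move=> heq seq; rewrite !guessE; congr (S a _ _); apply: funext => -[b bP] /=.
- by apply: heq; move: bP; rewrite inE.
- by apply: seq; move: bP; rewrite inE.
Qed.

(** Nobody is heard in the first inning, so only seen hats matter. With [c := a], irreflexivity of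
    [V] gives independence of one's own hat. *)
Lemma guess_recolor_first (f : A -> K) a c x :
    (forall b, 0 < I b) -> I a = 1 -> ~~ V a c ->
  guess S (recolor f c x) a = guess S f a.
Proof.
move=> I_gt0 Ia nVac; apply: guess_local => b.
  by rewrite Ia ltnS leqNgt I_gt0.
by move=> Vab; rewrite recolor_neq//; apply: contra nVac => /eqP<-.
Qed.

End Guess.

Theorem theorem4p8 (A : finType) (K : Type) (V : rel A) (I : A -> nat)
    (hA : 2 <= #|A|)
    (hK : infinite_set [set: K]%classic)
    (hV : visibility_graph V)
    (hI : inning_function I)
    (hIN : 2 <= last_inning I)
    (S3 : forall a : A, seen V a :&: heard I a = set0)
    (hP : exists2 P : (A -> K) -> A -> K, predictor V I P &
       forall (f : A -> K) (a b : A),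
         guesses_incorrectly P f a -> guesses_incorrectly P f b -> a = b) :
  #|inning I 1| = 1 /\
  (forall a : A, a \in inning I 1 -> seen V a = [set: A] :\ a).
Proof.
case: hP => P [S PE] P1.
have wrong1 f a b : guess S f a <> f a -> guess S f b <> f b -> a = b.
  by rewrite -!PE; exact: P1.
have [I_gt0 [a0 Ia0]] : (forall b, 0 < I b) /\ exists a, I a = 1.
  case: hI => alpha alpha0 /[dup] hal /(_ 1)[_ h1]; split.
    by move=> b; have /hal/andP[] : exists a, I a = I b by exists b.
  by apply: h1; rewrite /= lt0n.
have [x0 _] : ([set: K] !=set0)%classic by exact: infinite_setN0.
have [x1 [x10 _]] := infinite_avoid2 hK x0 x0.
have first_uniq a b : I a = 1 -> I b = 1 -> a = b.
  move=> Ia Ib; apply/eqP/negPn/negP => ab.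
  pose f x := recolor (fun=> x0) a x.
  (* The hat [y] keeps [b] wrong whichever of [x0], [x1] is worn by [a]. *)
  have [y [y0 y1]] := infinite_avoid2 hK (guess S (f x0) b) (guess S (f x1) b).
  pose g x := recolor (recolor (fun=> x0) b y) a x.
  (* The order in [g] suits the guess of [a]; the swapped order suits that of [b]. *)
  have gE x : g x = recolor (f x) b y.
    apply: funext => c; rewrite /g /f /recolor.
    by case: eqVneq => [->|//]; rewrite (negbTE ab).
  have [x [xa yb]] : exists x,
      guess S (recolor (fun=> x0) b y) a <> x /\ y <> guess S (f x) b.
    have [e|ne] := pselect (guess S (recolor (fun=> x0) b y) a = x0).
      by exists x1; split=> //; rewrite e; exact: nesym.
    by exists x0.
  have /eqP : a = b; last by rewrite (negbTE ab).
  apply: (wrong1 (g x)).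
    by rewrite /g guess_recolor_first ?hV// recolorE.
  by rewrite gE guess_recolor_first ?hV// recolorE; exact: nesym.
have sees_all a c : I a = 1 -> c != a -> V a c.
  move=> Ia ca; apply/negPn/negP => nVac.
  pose base : A -> K := fun=> x0.
  (* The hat [w] makes [a] wrong under every [f x], since [a] sees neither itself nor [c]. *)
  have [w [wa _]] := infinite_avoid2 hK (guess S base a) x0.
  pose f x := recolor (recolor base a w) c x.
  have fa x : guess S (f x) a = guess S base a.
    by rewrite /f !guess_recolor_first ?hV.
  have right x b : b != a -> guess S (f x) b = f x b.
    move=> ba; apply: contrapT => wb; move/eqP: ba; apply.
    apply: (wrong1 (f x)) => //; rewrite fa /f recolor_neq 1?eq_sym// recolorE.
    exact: nesym.
  (* As [c] is right under both colorings, equal guesses would force [x1 = x0]. *)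
  have : guess S (f x1) c = guess S (f x0) c.
    apply: guess_local => b.
      case: (eqVneq b a) => [-> _|ba bc]; first by rewrite !fa.
      have b_c : b != c by apply: contraTneq bc => ->; rewrite ltnn.
      by rewrite !right// /f !(recolor_neq _ _ _ _ b_c).
    move=> Vcb; have b_c : b != c by apply: contraTneq Vcb => ->; rewrite hV.
    by rewrite /f !(recolor_neq _ _ _ _ b_c).
  by rewrite !right// /f !recolorE.
split.
  apply/eqP/cards1P; exists a0; apply/setP => b; rewrite !inE.
  by apply/eqP/eqP => [/first_uniq/(_ Ia0)|->].
move=> a; rewrite inE => /eqP Ia; apply/setP => c; rewrite !inE andbT.
by apply/idP/idP => [|/sees_all->//]; apply: contraTneq => ->; rewrite hV.
Qed.
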